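(* For every integer $n \geq 0$, the map $\varphi: S_n(132) \to A_{2n+1}(132)$ (defined in the context via decreasing binary trees and their completions) is a bijection between the set of $132$-avoiding permutations of length $n$ and the set of alternating $132$-avoiding permutations of length $2n+1$.
   Context: A permutation $w = w_1w_2\cdots w_n$ of length $n$ is a sequence containing each of the integers $1,\dots,n$ exactly once (for $n=0$ there is exactly one, the empty permutation). It is alternating if $w_1 < w_2 > w_3 < w_4 > \cdots$. A sequence $w = w_1\cdots w_n$ of distinct integers contains a permutation $p$ of length $m$ (a pattern) if there are indices $1 \le i_1 < \cdots < i_m \le n$ such that $w_{i_1}\cdots w_{i_m}$ is order-isomorphic to $p$ (same relative order of entries); otherwise $w$ avoids $p$. $S_n(132)$ is the set of permutations of length $n$ avoiding $132$, and $A_{n}(132)$ is the set of alternating permutations of length $n$ avoiding $132$. Binary trees: each vertex has an optional left child and an optional right child, with left and right distinguished. For a finite sequence $w = w_1\cdots w_n$ of distinct integers, the labeled decreasing binary tree $T(w)$ is defined recursively: if $w$ is empty, $T(w)$ is empty; otherwise, if $w_k$ is the maximal entry, the root is labeled $w_k$, its left subtree is $T(w_1\cdots w_{k-1})$ and its right subtree is $T(w_{k+1}\cdots w_n)$. This is a bijection between permutations of length $n$ and decreasing binary trees labeled by $\{1,\dots,n\}$. If $w$ avoids $132$, then at each vertex $v$ of $T(w)$ every label in the left subtree at $v$ is larger than every label in the right subtree at $v$; each unlabeled binary tree with $m$ vertices has exactly one decreasing labeling by $\{1,\dots,m\}$ with this property, and it is called the labeled tree associated to the unlabeled tree. A binary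 tree is complete if every vertex has either zero or two children. The completion $C(T)$ of an unlabeled binary tree $T$ is obtained by adding vertices to $T$ so that every vertex of $T$ has two children in $C(T)$ and every vertex of $C(T)$ not in $T$ has no children in $C(T)$ (the completion of the empty tree is a single vertex). If $T$ has $n$ vertices, $C(T)$ has $2n+1$ vertices. The map $\varphi$: given $w \in S_n(132)$, form $T(w)$, erase its labels, take the completion, take the labeled tree associated to this completion, and let $\varphi(w)$ be the permutation of length $2n+1$ whose image under $T$ is that labeled tree. *)

(* Defs.v *)
From HB Require Import structures.
From mathcomp Require Import all_boot.
From mathcomp Require Import classical_sets functions.

Set Implicit Arguments.
Unset Strict Implicit.
Unset Printing Implicit Defensive.

(* Permutations are written in one-line notation, as sequences of naturals. *)

Definition is_permutation (n : nat) (w : seq nat) : bool :=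
  perm_eq w (iota 1 n).

(* Indices start at 0 here, so the rises are at the even positions. *)
Definition alternating (w : seq nat) : Prop :=
  forall i, i.+1 < size w ->
    if odd i then nth 0 w i.+1 < nth 0 w i else nth 0 w i < nth 0 w i.+1.

Definition order_isomorphic (s t : seq nat) : Prop :=
  size s = size t /\
  forall i j, i < size s -> j < size s ->
    (nth 0 s i < nth 0 s j) = (nth 0 t i < nth 0 t j).

Definition contains (w p : seq nat) : Prop :=
  exists2 s, subseq s w & order_isomorphic s p.

Definition avoids (w p : seq nat) : Prop := ~ contains w p.

Definition S132 (n : nat) : set (seq nat) :=
  [set w | is_permutation n w /\ avoids w [:: 1; 3; 2]]%classic.

Definition A132 (n : nat) : set (seq nat) :=
  [set w | [/\ is_permutation n w, alternating w
             & avoids w [:: 1; 3; 2]]]%classic.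

Inductive btree : Type :=
| Empty
| Node of btree & btree.

Inductive ltree : Type :=
| LEmpty
| LNode of ltree & nat & ltree.

Fixpoint btree_code (t : btree) : GenTree.tree nat :=
  if t is Node l r then GenTree.Node 0 [:: btree_code l; btree_code r]
  else GenTree.Leaf 0.

Fixpoint btree_decode (c : GenTree.tree nat) : option btree :=
  match c with
  | GenTree.Leaf _ => Some Empty
  | GenTree.Node _ [:: l; r] =>
      if (btree_decode l, btree_decode r) is (Some l', Some r')
      then Some (Node l' r') else None
  | _ => None
  end.

Lemma btree_codeK : pcancel btree_code btree_decode.
Proof. by elim=> //= l -> r ->. Qed.

HB.instance Definition _ := Choice.copy btree (pcan_type btree_codeK).

Fixpoint ltree_code (u : ltree) : GenTree.tree nat :=
  if u is LNode l x r then GenTree.Node x [:: ltree_code l; ltree_code r]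
  else GenTree.Leaf 0.

Fixpoint ltree_decode (c : GenTree.tree nat) : option ltree :=
  match c with
  | GenTree.Leaf _ => Some LEmpty
  | GenTree.Node x [:: l; r] =>
      if (ltree_decode l, ltree_decode r) is (Some l', Some r')
      then Some (LNode l' x r') else None
  | _ => None
  end.

Lemma ltree_codeK : pcancel ltree_code ltree_decode.
Proof. by elim=> //= l -> x r ->. Qed.

HB.instance Definition _ := Choice.copy ltree (pcan_type ltree_codeK).

Fixpoint num_vertices (t : btree) : nat :=
  if t is Node l r then (num_vertices l + num_vertices r).+1 else 0.

Fixpoint erase_labels (u : ltree) : btree :=
  if u is LNode l _ r then Node (erase_labels l) (erase_labels r) else Empty.

Fixpoint labels (u : ltree) : seq nat :=
  if u is LNode l x r then labels l ++ x :: labels r else [::].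

(* The first argument bounds the recursion depth; see [decr_treeE]. *)
Fixpoint decr_tree_rec (d : nat) (w : seq nat) : ltree :=
  if d is d'.+1 then
    if w is [::] then LEmpty
    else let m := \max_(x <- w) x in
         let k := index m w in
         LNode (decr_tree_rec d' (take k w)) m (decr_tree_rec d' (drop k.+1 w))
  else LEmpty.

Definition decr_tree (w : seq nat) : ltree := decr_tree_rec (size w) w.

Fixpoint decreasing (u : ltree) : bool :=
  if u is LNode l x r then
    [&& all (fun y => y < x) (labels l), all (fun y => y < x) (labels r),
        decreasing l & decreasing r]
  else true.

Fixpoint left_above_right (u : ltree) : bool :=
  if u is LNode l _ r then
    [&& allrel (fun a b => b < a) (labels l) (labels r),
        left_above_right l & left_above_right r]
  else true.

Definition is_associated (t : btree) (u : ltree) : bool :=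
  [&& erase_labels u == t, is_permutation (num_vertices t) (labels u),
      decreasing u & left_above_right u].

(* Every empty child position receives a new vertex without children. *)
Fixpoint completion (t : btree) : btree :=
  if t is Node l r then Node (completion l) (completion r)
  else Node Empty Empty.

Lemma num_vertices_completion t :
  num_vertices (completion t) = (2 * num_vertices t).+1.
Proof.
elim: t => //= l -> r ->.
by rewrite addSn addnS !mulnS mulnDr !add2n.
Qed.

Lemma index_max_lt w : w != [::] -> index (\max_(x <- w) x) w < size w.
Proof.
move=> w0; rewrite index_mem; elim: w w0 => // a w IH _.
rewrite big_cons inE; case: leqP => [lt|_]; last by rewrite eqxx.
have [w0|w0] := eqVneq w [::]; last by rewrite IH ?orbT.
by move: lt; rewrite w0 big_nil leqn0 => /eqP->; rewrite eqxx.
Qed.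

Lemma size_take_max w : w != [::] ->
  size (take (index (\max_(x <- w) x) w) w) < size w.
Proof. by move=> /index_max_lt lt; rewrite size_take_min gtn_min lt. Qed.

Lemma size_drop_max w : w != [::] ->
  size (drop (index (\max_(x <- w) x) w).+1 w) < size w.
Proof.
by case: w => // a w _; rewrite size_drop subSS ltnS leq_subr.
Qed.

Lemma decr_tree_rec_cons d w : w != [::] -> decr_tree_rec d.+1 w =
  let m := \max_(x <- w) x in
  let k := index m w in
  LNode (decr_tree_rec d (take k w)) m (decr_tree_rec d (drop k.+1 w)).
Proof. by case: w. Qed.

Lemma decr_tree_rec_stable d w : size w <= d -> decr_tree_rec d w = decr_tree w.
Proof.
rewrite /decr_tree; have [n] := ubnP (size w).
elim: n d w => // n IH d w ltn led.
have [->|w0] := eqVneq w [::]; first by case: d {led}.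
have st := size_take_max w0; have sd := size_drop_max w0.
case: d led => [|d] led; first by move: led w0; rewrite leqn0 size_eq0 => ->.
case E: (size w) => [|p]; first by move: w0; rewrite -size_eq0 E.
rewrite !decr_tree_rec_cons //=.
rewrite E !ltnS in ltn led st sd.
congr LNode; rewrite [LHS]IH ?[RHS]IH //;
  by [apply: leq_ltn_trans ltn | apply: leq_trans led].
Qed.

Lemma decr_treeE w : w != [::] -> decr_tree w =
  let m := \max_(x <- w) x in
  let k := index m w in
  LNode (decr_tree (take k w)) m (decr_tree (drop k.+1 w)).
Proof.
move=> w0; have st := size_take_max w0; have sd := size_drop_max w0.
rewrite {1}/decr_tree; case E: (size w) => [|p].
  by move: w0; rewrite -size_eq0 E.
rewrite E !ltnS in st sd.
by rewrite decr_tree_rec_cons //= !decr_tree_rec_stable.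
Qed.

Lemma decr_treeK : cancel decr_tree labels.
Proof.
move=> w; have [n] := ubnP (size w); elim: n w => // n IH w ltn.
have [->//|w0] := eqVneq w [::].
have st := size_take_max w0; have sd := size_drop_max w0.
have lt := index_max_lt w0.
rewrite decr_treeE //= !IH ?(leq_trans _ (ltn : size w <= n)) //.
rewrite -[X in X :: drop _ _](nth_index 0 (_ : \max_(x <- w) x \in w)).
  by rewrite -drop_nth // cat_take_drop.
by rewrite -index_mem.
Qed.

Lemma decr_tree_labels u : decreasing u -> decr_tree (labels u) = u.
Proof.
elim: u => //= l IHl x r IHr /and4P[xl xr /IHl dl /IHr dr].
rewrite decr_treeE /=; last by case: (labels l) => [|? ?].
have -> : \max_(y <- labels l ++ x :: labels r) y = x.
  apply/eqP; rewrite eqn_leq; apply/andP; split.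
    apply/bigmax_leqP_seq => y; rewrite mem_cat inE => /or3P[yl|/eqP->//|yr] _.
      exact/ltnW/(allP xl).
    exact/ltnW/(allP xr).
  by rewrite big_cat big_cons /= leq_max leq_max leqnn orbT.
have -> : index x (labels l ++ x :: labels r) = size (labels l).
  rewrite index_cat /= eqxx addn0.
  by case: ifP => // /(allP xl); rewrite ltnn.
by rewrite take_size_cat // -cat_rcons drop_size_cat ?size_rcons //= dl dr.
Qed.

Lemma size_labels u : size (labels u) = num_vertices (erase_labels u).
Proof. by elim: u => //= l IHl x r IHr; rewrite size_cat /= IHl IHr addnS. Qed.

(* The associated labeling, shifted so that the least label is m. *)
Fixpoint label_from (m : nat) (t : btree) : ltree :=
  if t is Node l r then
    LNode (label_from (m + num_vertices r) l)
          (m + (num_vertices r + num_vertices l))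
          (label_from m r)
  else LEmpty.

Lemma perm_label_from m t :
  perm_eq (labels (label_from m t)) (iota m (num_vertices t)).
Proof.
elim: t m => // l IHl r IHr m; apply/permP => p.
have -> : num_vertices (Node l r) = num_vertices r + num_vertices l + 1.
  by rewrite addn1 addnC.
rewrite !iotaD !count_cat /= (permP (IHl _)) (permP (IHr _)).
by rewrite addn0 addnA addnC addnA.
Qed.

Lemma mem_label_from m t x :
  (x \in labels (label_from m t)) = (m <= x < m + num_vertices t).
Proof. by rewrite (perm_mem (perm_label_from m t)) mem_iota. Qed.

Lemma erase_label_from m t : erase_labels (label_from m t) = t.
Proof. by elim: t m => //= l IHl r IHr m; rewrite IHl IHr. Qed.

Lemma decreasing_label_from m t : decreasing (label_from m t).
Proof.
elim: t m => //= l IHl r IHr m; rewrite IHl IHr !andbT.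
apply/andP; split; apply/allP => x; rewrite mem_label_from => /andP[_].
  by rewrite addnA.
by move=> lt; rewrite addnA ltn_addr.
Qed.

Lemma left_above_right_label_from m t : left_above_right (label_from m t).
Proof.
elim: t m => //= l IHl r IHr m; rewrite IHl IHr !andbT.
apply/allrelP => a b; rewrite !mem_label_from => /andP[la _] /andP[_ ub].
exact: leq_trans ub la.
Qed.

Lemma associated_tree_exists t : exists u, is_associated t u.
Proof.
exists (label_from 1 t); rewrite /is_associated erase_label_from eqxx /=.
rewrite /is_permutation perm_label_from /=.
by rewrite decreasing_label_from left_above_right_label_from.
Qed.

Lemma label_from_unique m u :
  perm_eq (labels u) (iota m (num_vertices (erase_labels u))) ->
  decreasing u -> left_above_right u -> u = label_from m (erase_labels u).
Proof.
elim: u m => // l IHl x r IHr m; rewrite -!size_labels in IHl IHr *.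
rewrite [size _]size_cat addnS => pu /and4P[xl xr dl dr] /and3P[lr sl sr].
pose s := sort leq (labels r) ++ sort leq (labels l) ++ [:: x].
have ps : perm_eq s (iota m (size (labels l) + size (labels r)).+1).
  apply: perm_trans pu; apply/permP => p; rewrite !count_cat /= !count_sort addn0.
  by rewrite addnC -addnA.
have ss : sorted leq s.
  rewrite (sorted_pairwise leq_trans) !pairwise_cat /= !allrel_catr.
  rewrite -!(sorted_pairwise leq_trans) !(sort_sorted leq_total) /= !andbT.
  rewrite -andbA; apply/and3P; split; apply/allrelP => a b; rewrite !mem_sort ?mem_seq1.
  - by move=> ar bl; apply/ltnW/(allrelP lr).
  - by move=> /(allP xr) /ltnW ? /eqP->.
  - by move=> /(allP xl) /ltnW ? /eqP->.
have := sorted_eq leq_trans anti_leq ss (iota_sorted _ _) ps.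
rewrite [size (labels l) + _]addnC -(addn1 (_ + _)) !iotaD -catA => /eqP.
rewrite eqseq_cat ?size_sort ?size_iota // eqseq_cat ?size_sort ?size_iota //.
move=> /and3P[/eqP er /eqP el /eqP[ex]].
rewrite /= -!size_labels; congr LNode => //.
- by apply: IHl => //; rewrite -?size_labels -el perm_sym perm_sort.
- by apply: IHr => //; rewrite -?size_labels -er perm_sym perm_sort.
Qed.

Lemma associated_tree_unique t u v :
  is_associated t u -> is_associated t v -> u = v.
Proof.
move=> /and4P[/eqP <- pu du su] /and4P[/eqP ev pv dv sv].
rewrite (label_from_unique (m := 1) _ du su) // -?ev.
by rewrite -(label_from_unique (m := 1) _ dv sv) // ev.
Qed.

(* The labeled tree associated to t; it is unique by
   [associated_tree_unique]. *)
Definition associated_tree (t : btree) : ltree :=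
  xchoose (associated_tree_exists t).

Definition completed_tree (w : seq nat) : ltree :=
  associated_tree (completion (erase_labels (decr_tree w))).

Lemma phi_exists w : exists v,
  is_permutation (2 * size w).+1 v && (decr_tree v == completed_tree w).
Proof.
exists (labels (completed_tree w)).
have /and4P[_ p d _] : is_associated _ (completed_tree w) := xchooseP _.
rewrite decr_tree_labels // eqxx andbT.
by move: p; rewrite num_vertices_completion -size_labels decr_treeK.
Qed.

(* The permutation of length 2 (size w) + 1 that [decr_tree] sends to
   [completed_tree w]; it is unique by [decr_treeK]. *)
Definition phi (w : seq nat) : seq nat := xchoose (phi_exists w).

(* Main.v *)
Require Import Defs.
From mathcomp Require Import all_boot.
From mathcomp Require Import classical_sets functions.

(** In-order reading of a decreasing tree: [132]-avoidance says that left
    subtrees lie above right subtrees, so a [132]-avoiding permutation is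
    determined by the shape of its tree. Being alternating of odd length says
    that this shape is a completion: the last entry of a nonempty left subtree
    precedes a rise to the root, which forces that subtree, and by parity the
    right one, to have odd size, while a root without left child starts the
    sequence and must be followed by a rise, so it has no right child either.
    Since [completion] is injective, [phi] is bijective. *)

Lemma contains132P (w : seq nat) :
  contains w [:: 1; 3; 2] <->
  exists a b c, subseq [:: a; c; b] w /\ a < b < c.
Proof.
split=> [[s sw [sz iso]]|[a [b [c [sw /andP[ab bc]]]]]].
  case: s sz sw iso => [|a [|c [|b []]]] //= _ sw iso.
  exists a, b, c; split=> //.
  by rewrite (iso 0 2) // (iso 2 1).
have ac := ltn_trans ab bc.
exists [:: a; c; b] => //; split=> // -[|[|[|i]]] // [|[|[|j]]] //= _ _;
  by rewrite ?ltnn ?ab ?bc ?ac // ltnNge ltnW.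
Qed.

Lemma avoids_subseq (p v w : seq nat) : subseq v w -> avoids w p -> avoids v p.
Proof. by move=> vw av [s sv so]; apply: av; exists s => //; apply: subseq_trans vw. Qed.

Lemma subseq_cat_split {T : eqType} (s s1 s2 : seq T) : subseq s (s1 ++ s2) ->
  exists t1 t2, [/\ s = t1 ++ t2, subseq t1 s1 & subseq t2 s2].
Proof.
case/subseqP=> m sm ->.
exists (mask (take (size s1) m) s1), (mask (drop (size s1) m) s2).
rewrite !mask_subseq -mask_cat ?cat_take_drop //.
by rewrite size_take_min sm size_cat; apply/minn_idPl/leq_addr.
Qed.

(** An occurrence [a], [c], [b] not inside one subtree either has [a] in the left subtree and
    [b > a] in the right one, against [left_above_right], or has the root as its smaller entry [a]
    or [b], below the label [c], against [decreasing]. *)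
Lemma left_above_right_avoids132 (u : ltree) :
  decreasing u -> left_above_right u -> avoids (labels u) [:: 1; 3; 2].
Proof.
move=> du su /contains132P[a [b [c [sub /andP[ab bc]]]]]; move: du su sub.
elim: u => //= l IHl x r IHr /and4P[/allP xl /allP xr dl dr].
case/and3P=> /allrelP lr sl sr /subseq_cat_split[t1 [t2 [E sub1 sub2]]].
(* The root comes first in this half, so when [c] and [b] both fall into it, [b] is a label of the
   right subtree. *)
have ge2 y z : subseq [:: y; z] (x :: labels r) -> z \in labels r.
  by rewrite /=; case: eqP => _ /mem_subseq; apply; rewrite !inE eqxx ?orbT.
case: t1 E sub1 => [|y1 [|y2 [|y3 t1]]] /=.
- move=> E _; rewrite -E /= in sub2; move: sub2; case: eqP => [E1|_].
    move=> /mem_subseq sub; have := xr c (sub c (mem_head _ _)).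
    by rewrite -E1 ltnNge (ltnW (ltn_trans ab bc)).
  exact: IHr.
- case=> <- E2; rewrite sub1seq => al; rewrite -E2 in sub2.
  by have := lr _ _ al (ge2 _ _ sub2); rewrite ltnNge (ltnW ab).
- case=> <- <- E2 /mem_subseq sub1; rewrite -E2 sub1seq inE in sub2.
  have al : a \in labels l by apply: sub1; rewrite inE eqxx.
  have cl : c \in labels l by apply: sub1; rewrite !inE eqxx orbT.
  case/orP: sub2 => [/eqP bx|br].
    by have := xl _ cl; rewrite -bx ltnNge (ltnW bc).
  by have := lr _ _ al br; rewrite ltnNge (ltnW ab).
- by case=> <- <- <- E2; case: t1 E2 => //= _; apply: IHl.
Qed.

(** A left label [a] below a right label [b] would form the pattern with the root between them;
    distinctness rules out [a = b]. *)
Lemma avoids132_left_above_right (u : ltree) :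
  uniq (labels u) -> decreasing u -> avoids (labels u) [:: 1; 3; 2] ->
  left_above_right u.
Proof.
elim: u => //= l IHl x r IHr.
rewrite cat_uniq => /and3P[ul /= /norP[_ dis] /andP[_ ur]].
case/and4P=> /allP xl /allP xr dl dr av; apply/and3P; split.
- apply/allrelP=> a b al br; rewrite ltnNge leq_eqVlt; apply/negP=> /orP[/eqP ab|ab].
    by case/hasP: dis; exists b; rewrite // -ab.
  apply: av; apply/contains132P; exists a, b, x; split; last by rewrite ab xr.
  by rewrite -[[:: a; x; b]]/([:: a] ++ [:: x; b]) cat_subseq ?sub1seq //= eqxx sub1seq.
- exact/IHl/(avoids_subseq _ _ _ (prefix_subseq _ _) av).
- apply/IHr/(avoids_subseq _ _ _ _ av) => //.
  exact: subseq_trans (subseq_cons _ _) (suffix_subseq _ _).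
Qed.

Lemma decreasing_decr_tree (w : seq nat) : uniq w -> decreasing (decr_tree w).
Proof.
have [n] := ubnP (size w); elim: n w => // n IH w ltn uw.
have [->//|w0] := eqVneq w [::].
have st := size_take_max w0; have sd := size_drop_max w0.
have := index_max_lt w0; rewrite index_mem.
rewrite decr_treeE //=; set m := \max_(x <- w) x in st sd * => mw.
rewrite !decr_treeK !IH ?take_uniq ?drop_uniq ?(leq_trans _ (ltn : size w <= n)) //.
rewrite !andbT.
have le y : y \in w -> y <= m by move=> yw; apply: leq_bigmax_seq.
have Ew : w = take (index m w) w ++ m :: drop (index m w).+1 w.
  by rewrite -{2}(nth_index 0 mw) -drop_nth ?index_mem // cat_take_drop.
move: uw; rewrite {1}Ew cat_uniq /= negb_or => /and3P[_ /andP[mt _] /andP[md _]].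
apply/andP; split; apply/allP=> y yw; rewrite ltn_neqAle le ?(mem_take yw) ?(mem_drop yw) // andbT.
  exact: (memPn mt).
exact: (memPn md).
Qed.

(** The odd size puts [x] at an odd index, a peak, so both comparisons with [x] come for free; [t]
    is shifted by an even amount, so its rises and falls keep their places. *)
Lemma alternating_cat_peak (s t : seq nat) (x : nat) : odd (size s) ->
  all (fun y => y < x) s -> all (fun y => y < x) t ->
  alternating (s ++ x :: t) <-> alternating s /\ alternating t.
Proof.
move=> os /allP sx /allP tx.
have nthl i : i < size s -> nth 0 (s ++ x :: t) i = nth 0 s i.
  by move=> lt; rewrite nth_cat lt.
have nthr i : nth 0 (s ++ x :: t) ((size s).+1 + i) = nth 0 t i.
  by rewrite nth_cat addSnnS ltnNge leq_addr /= addKn.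
have nthx : nth 0 (s ++ x :: t) (size s) = x by rewrite nth_cat ltnn subnn.
have sz : size (s ++ x :: t) = (size s).+1 + size t.
  by rewrite size_cat /= addnS addSn.
split=> [alt|[alts altt] i].
  split=> i lt.
    have lti := ltn_trans (ltnSn i) lt.
    have := alt i; rewrite sz (nthl i) // (nthl i.+1) //; apply.
    by rewrite addSn ltnS (leq_trans (ltnW lt)) ?leq_addr.
  have := alt ((size s).+1 + i); rewrite -addnS !nthr sz ltn_add2l => /(_ lt).
  by rewrite oddD /= os.
(* The pair at [i], [i.+1] lies inside [s], starts at or after [x], or ends at [x]. *)
rewrite sz => lt; case: (ltngtP i.+1 (size s)) => [lts|gts|eqs].
- have lti := ltn_trans (ltnSn i) lts.
  by rewrite (nthl i) // (nthl i.+1) //; apply: alts.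
- move: gts; rewrite ltnS leq_eqVlt => /orP[/eqP eqs|gts].
    rewrite -eqs os -[X in nth _ _ X](addn0 (size s).+1) nthr nthx tx // mem_nth //.
    by rewrite -eqs -{1}(addn0 (size s).+1) ltn_add2l in lt.
  rewrite -(subnKC gts) -addnS !nthr oddD /= os /=; apply: altt.
  by rewrite -(ltn_add2l (size s).+1) addnS subnKC.
- move: (os); rewrite -eqs /= => /negbTE->; rewrite [in X in _ < X]eqs nthx.
  by rewrite nthl ?sx ?mem_nth // -eqs.
Qed.

(** Avoidance is left out, and oddness is built in to exclude the empty tree, which is no
    completion; in this form the claim passes to both subtrees. *)
Lemma alternating_completionP (u : ltree) : decreasing u ->
  (odd (size (labels u)) /\ alternating (labels u)) <->
  (exists t, erase_labels u = completion t).
Proof.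
elim: u => [_|l IHl x r IHr /= /and4P[xl xr dl dr]].
  by split=> [[]|[[]]].
have {IHl}IHl := IHl dl; have {IHr}IHr := IHr dr.
have szu : size (labels l ++ x :: labels r) = (size (labels l) + size (labels r)).+1.
  by rewrite size_cat addnS.
split=> [[ou alt]|[[|tl tr] /=]].
- have [l0|l0] := posnP (size (labels l)).
    (* Here [x] is the first entry, so an entry after it would have to exceed the maximum. *)
    have r0 : size (labels r) = 0.
      case: (labels r) xr alt => [|y s] //= /andP[yx _].
      rewrite (size0nil l0) /= => /(_ 0 isT) /=.
      by rewrite ltnNge (ltnW yx).
    rewrite !size_labels in l0 r0.
    exists Defs.Empty => /=.
    by case: (erase_labels l) l0 => //; case: (erase_labels r) r0.
  have ol : odd (size (labels l)).
    (* The last left entry rises to [x], so its index is even and the left size odd. *)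
    have := alt (size (labels l)).-1; rewrite prednK // szu ltnS leq_addr => /(_ isT).
    rewrite !nth_cat ltnn subnn /= ltn_predL l0.
    rewrite -{4}(prednK l0) /=; case: odd => //.
    by rewrite ltnNge ltnW // (allP xl) // mem_nth // ltn_predL.
  have /(alternating_cat_peak _ _ _ ol xl xr)[altl altr] := alt.
  move: ou; rewrite szu /= oddD ol /= negbK => orr.
  have /IHl[tl ->] : odd (size (labels l)) /\ alternating (labels l) by [].
  have /IHr[tr ->] : odd (size (labels r)) /\ alternating (labels r) by [].
  by exists (Node tl tr).
- by case: l {IHl xl dl szu} => // -[]; case: r {IHr xr dr} => // _; split=> // -[].
- case=> el er.
  have [|ol altl] := IHl.2; first by exists tl.
  have [|orr altr] := IHr.2; first by exists tr.
  by rewrite szu /= oddD ol orr; split=> //; apply/alternating_cat_peak.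
Qed.

(** No completion is empty, so a single vertex can only complete the empty tree. *)
Lemma completion_inj : injective completion.
Proof.
have nonempty t : completion t <> Defs.Empty by case: t.
elim=> [|l IHl r IHr] [|l' r'] //= [].
- by move=> E; case: (nonempty l').
- by move=> E; case: (nonempty l).
- by move=> /IHl-> /IHr->.
Qed.

Lemma is_permutation_uniq (n : nat) (w : seq nat) : is_permutation n w -> uniq w.
Proof. by move/perm_uniq->; apply: iota_uniq. Qed.

Lemma is_permutation_size (n : nat) (w : seq nat) : is_permutation n w -> size w = n.
Proof. by move/perm_size->; apply: size_iota. Qed.

Definition tree_shape (w : seq nat) : btree := erase_labels (decr_tree w).

Definition perm132_of (t : btree) : seq nat := labels (label_from 1 t).

Lemma num_vertices_tree_shape (w : seq nat) : num_vertices (tree_shape w) = size w.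
Proof. by rewrite -size_labels decr_treeK. Qed.

Lemma perm132_ofK : cancel perm132_of tree_shape.
Proof.
by move=> t; rewrite /tree_shape decr_tree_labels ?decreasing_label_from ?erase_label_from.
Qed.

(** Avoidance makes [decr_tree w] satisfy [left_above_right], and such a labeling is determined by
    its shape. *)
Lemma tree_shapeK (n : nat) (w : seq nat) : S132 n w -> perm132_of (tree_shape w) = w.
Proof.
case=> pw av; have uw := is_permutation_uniq _ _ pw.
have dw := decreasing_decr_tree _ uw.
rewrite /perm132_of /tree_shape -label_from_unique ?decr_treeK //.
  by rewrite -size_labels decr_treeK (is_permutation_size _ _ pw).
by apply: avoids132_left_above_right; rewrite ?decr_treeK.
Qed.

Lemma S132_perm132_of (t : btree) : S132 (num_vertices t) (perm132_of t).
Proof.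
split; first exact: perm_label_from.
apply: left_above_right_avoids132.
  exact: decreasing_label_from.
exact: left_above_right_label_from.
Qed.

Lemma associated_treeE (t : btree) : associated_tree t = label_from 1 t.
Proof.
apply: (associated_tree_unique (t := t)); first exact: xchooseP.
rewrite /is_associated erase_label_from eqxx decreasing_label_from.
by rewrite left_above_right_label_from !andbT; apply: perm_label_from.
Qed.

(** Eliminates the choices in [phi]: it is [completion] transported along the correspondence between
    trees and 132-avoiding permutations. *)
Lemma phiE (w : seq nat) : phi w = perm132_of (completion (tree_shape w)).
Proof.
have /andP[_ /eqP E] := xchooseP (phi_exists w).
by rewrite -[LHS]decr_treeK /phi E /completed_tree associated_treeE.
Qed.

Theorem mainTheorem1 (n : nat) : set_bij (S132 n) (A132 (2 * n).+1) phi.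
Proof.
split.
- move=> w Sw; have [pw _] := Sw; rewrite phiE.
  have := S132_perm132_of (completion (tree_shape w)).
  rewrite num_vertices_completion num_vertices_tree_shape (is_permutation_size _ _ pw).
  case=> pv av; split=> //.
  apply: (proj2 ((alternating_completionP _ (decreasing_label_from _ _)).2 _)).
  by exists (tree_shape w); rewrite erase_label_from.
- move=> w w' /set_mem Sw /set_mem Sw'; rewrite !phiE.
  move/(can_inj perm132_ofK)/completion_inj => E.
  by rewrite -(tree_shapeK _ _ Sw) E (tree_shapeK _ _ Sw').
- move=> v [pv altv av].
  have sv := is_permutation_size _ _ pv.
  (* The length [2n+1] is odd, so the shape of [v] completes some [t]; the word of [t] will be the
     preimage. *)
  have [|t Et] := (alternating_completionP _ (decreasing_decr_tree _ (is_permutation_uniq _ _ pv))).1.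
    by rewrite decr_treeK sv mul2n /= odd_double.
  (* Counting vertices of the completion gives [2 * num_vertices t + 1 = 2n+1]. *)
  have nt : num_vertices t = n.
    have := num_vertices_tree_shape v; rewrite /tree_shape Et num_vertices_completion sv.
    by move=> [] /eqP; rewrite eqn_pmul2l // => /eqP.
  exists (perm132_of t); first by rewrite -nt; apply: S132_perm132_of.
  by rewrite phiE perm132_ofK -Et; apply: (tree_shapeK (2 * n).+1).
Qed.
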